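(* Let $\eta_1,\eta_2,\eta_1',\eta_2'\in\mathbb{K}$ and $\zeta_1,\zeta_2,\zeta_1',\zeta_2'\in\mathbb{K}^*$. Every simple right $A_2^{\underline{q},\Lambda}$-module of type $(M_4,\eta_1,\eta_2,\zeta_1,\zeta_2)$ has $\mathbb{K}$-dimension $l_1l_2$. Moreover, simple modules of types $(M_4,\eta_1,\eta_2,\zeta_1,\zeta_2)$ and $(M_4,\eta_1',\eta_2',\zeta_1',\zeta_2')$ are isomorphic if and only if $\eta_1=\eta_1'$, $\eta_2=\eta_2'$, $\zeta_1=q_1^{-a}\zeta_1'$ and $\zeta_2=q_1^{-a}q_2^{-b}\zeta_2'$ for some $0\le a\le l_1-1$ and $0\le b\le l_2-1$.
   Context: $\mathbb{K}$ is an algebraically closed field of arbitrary characteristic. $q_1,q_2\in\mathbb{K}\setminus\{0,1\}$ and $\lambda\in\mathbb{K}^*$, where $q_i$ is a primitive $l_i$-th root of unity ($i=1,2$) and $\lambda^{l_1}=1$. All modules are right modules. $A_2^{\underline{q},\Lambda}$ is the unital associative $\mathbb{K}$-algebra generated by $x_1,y_1,x_2,y_2$ subject to $$x_1x_2=q_1\lambda x_2x_1,\quad x_1y_2=\lambda^{-1}y_2x_1,\quad y_1y_2=\lambda y_2y_1,\quad y_1x_2=q_1^{-1}\lambda^{-1}x_2y_1,$$ $$x_1y_1-q_1y_1x_1=1,\qquad x_2y_2-q_2y_2x_2=1+(q_1-1)y_1x_1.$$ Put $z_i=x_iy_i-y_ix_i$ for $i=1,2$; these are normal elements, so each acts on a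 simple module either as zero or invertibly. The elements $x_1^{l_1},x_2^{l_2},y_1^{l_1},y_2^{l_2},z_1,z_2$ commute with each other. A simple module of type $(M_4,\eta_1,\eta_2,\zeta_1,\zeta_2)$ is a simple right $A_2^{\underline{q},\Lambda}$-module $M$ on which $z_1,z_2$ act invertibly and $x_1,x_2$ act nilpotently, and which contains a nonzero vector $w$ such that $$wx_1=0,\quad wx_2=0,\quad wy_i^{l_i}=\eta_iw,\quad wz_i=\zeta_iw\qquad(i=1,2).$$ Such an $M$ is denoted $(M_4,\eta_1,\eta_2,\zeta_1,\zeta_2)$. *)

(* Defs.v *)
From HB Require Import structures.
From mathcomp Require Import all_boot all_algebra.
From mathcomp Require Import ring_quotient generic_quotient.
From mathcomp Require Import boolp.
From mathcomp Require Import monalg.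

Set Implicit Arguments.
Unset Strict Implicit.
Unset Printing Implicit Defensive.

Import GRing.Theory.
Local Open Scope ring_scope.
Local Open Scope quotient_scope.

(* K<I> / (rels): the free associative unital K-algebra on the set I, i.e. the
   monoid algebra of the free monoid on I, modulo the two-sided ideal
   generated by the finite set of relators rels. *)

Notation free_alg K I := {malg K[{fmonom I}]}.

Section PresentedAlgebra.
Variables (K : comNzRingType) (I : choiceType) (rels : seq (free_alg K I)).
Local Notation F := (free_alg K I).

Definition in_ideal (f : F) : Prop :=
  exists2 s : seq (F * F * F), all (fun t => t.1.2 \in rels) s &
    f = \sum_(t <- s) t.1.1 * t.1.2 * t.2.

Definition ideal : {pred F} := [pred f | `[< in_ideal f >]].

Lemma idealP f : reflect (in_ideal f) (f \in ideal).
Proof. by rewrite inE; exact: asboolP. Qed.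

Lemma ideal_rel r : r \in rels -> r \in ideal.
Proof.
move=> rr; apply/idealP; exists [:: (1, r, 1)]; first by rewrite /= rr.
by rewrite big_seq1 /= mul1r mulr1.
Qed.

Lemma idealMl g f : f \in ideal -> g * f \in ideal.
Proof.
case/idealP=> s ss ->; apply/idealP.
exists [seq (g * t.1.1, t.1.2, t.2) | t <- s]; first by rewrite all_map.
by rewrite big_map mulr_sumr; apply: eq_bigr => t _; rewrite !mulrA.
Qed.

Lemma idealMr g f : f \in ideal -> f * g \in ideal.
Proof.
case/idealP=> s ss ->; apply/idealP.
exists [seq (t.1.1, t.1.2, t.2 * g) | t <- s]; first by rewrite all_map.
by rewrite big_map mulr_suml; apply: eq_bigr => t _; rewrite !mulrA.
Qed.

Fact ideal_zmod_closed : zmod_closed ideal.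
Proof.
split=> [|f g If Ig]; first by apply/idealP; exists [::]; rewrite ?big_nil.
have: - 1 * g \in ideal by exact: idealMl.
case/idealP: If => s ss -> /idealP[s' ss' e]; apply/idealP.
exists (s ++ s'); first by rewrite all_cat ss.
by rewrite big_cat /= -e mulN1r.
Qed.
HB.instance Definition _ := GRing.isZmodClosed.Build F ideal ideal_zmod_closed.

Definition presented : Type := Quotient.quot ideal.
HB.instance Definition _ := GRing.Zmodule.on presented.

Definition pr (f : F) : presented := \pi_(Quotient.quot ideal) f.

Lemma pr_eqP f g : reflect (pr f = pr g) (f - g \in ideal).
Proof. by rewrite Quotient.idealrBE; exact: eqP. Qed.

Lemma prK (a : presented) : pr (repr (a : Quotient.quot ideal)) = a.
Proof. exact: reprK. Qed.

Lemma prD f g : pr (f + g) = pr f + pr g.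
Proof. exact: (raddfD \pi_(Quotient.quot ideal)). Qed.

Definition presented_one : presented := pr 1.
Definition presented_mul (a b : presented) : presented :=
  pr (repr (a : Quotient.quot ideal) * repr (b : Quotient.quot ideal)).
Definition presented_scale (c : K) (a : presented) : presented :=
  pr (c *: repr (a : Quotient.quot ideal)).

Fact pr_mul f g : presented_mul (pr f) (pr g) = pr (f * g).
Proof.
set u := repr (pr f : Quotient.quot ideal).
set v := repr (pr g : Quotient.quot ideal).
have Iu : u - f \in ideal by apply/pr_eqP; exact: prK.
have Iv : v - g \in ideal by apply/pr_eqP; exact: prK.
apply/pr_eqP.
have -> : u * v - f * g = (u - f) * v + f * (v - g).
  by rewrite mulrBl mulrBr addrA subrK.
by apply: rpredD; [exact: idealMr | exact: idealMl].
Qed.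

Fact pr_scale c f : presented_scale c (pr f) = pr (c *: f).
Proof.
apply/pr_eqP; rewrite -scalerBr -mul_malgC.
by apply: idealMl; apply/pr_eqP; exact: prK.
Qed.

Fact presented_mulA : associative presented_mul.
Proof.
by move=> a b c; rewrite -(prK a) -(prK b) -(prK c) !pr_mul mulrA.
Qed.

Fact presented_mul1 : left_id presented_one presented_mul.
Proof. by move=> a; rewrite -(prK a) pr_mul mul1r. Qed.

Fact presented_mulr1 : right_id presented_one presented_mul.
Proof. by move=> a; rewrite -(prK a) pr_mul mulr1. Qed.

Fact presented_mulDl : left_distributive presented_mul +%R.
Proof.
by move=> a b c; rewrite -(prK a) -(prK b) -(prK c) -prD !pr_mul mulrDl prD.
Qed.

Fact presented_mulDr : right_distributive presented_mul +%R.
Proof.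
by move=> a b c; rewrite -(prK a) -(prK b) -(prK c) -prD !pr_mul mulrDr prD.
Qed.

(* 1 = 0 is not excluded for arbitrary relators, hence no nzRingType (and so no
   algType) structure: presented is a pzRingType and an lmodType K in which
   scaling is compatible with the product (presented_scaleAl/Ar). *)
HB.instance Definition _ := GRing.Zmodule_isPzRing.Build presented
  presented_mulA presented_mul1 presented_mulr1 presented_mulDl presented_mulDr.

Fact presented_scaleA c d a :
  presented_scale c (presented_scale d a) = presented_scale (c * d) a.
Proof. by rewrite -(prK a) !pr_scale scalerA. Qed.

Fact presented_scale1 : left_id 1 presented_scale.
Proof. by move=> a; rewrite -(prK a) pr_scale scale1r. Qed.

Fact presented_scaleDr : right_distributive presented_scale +%R.
Proof.
by move=> c a b; rewrite -(prK a) -(prK b) -prD !pr_scale scalerDr prD.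
Qed.

Fact presented_scaleDl a :
  {morph presented_scale^~ a : c d / c + d}.
Proof. by move=> c d; rewrite -(prK a) !pr_scale scalerDl prD. Qed.

HB.instance Definition _ := GRing.Zmodule_isLmodule.Build K presented
  presented_scaleA presented_scale1 presented_scaleDr presented_scaleDl.

Lemma pr1 : pr 1 = 1. Proof. by []. Qed.

Lemma prM f g : pr (f * g) = pr f * pr g.
Proof. by rewrite -pr_mul. Qed.

Lemma prZ c f : pr (c *: f) = c *: pr f.
Proof. by rewrite -pr_scale. Qed.

Lemma presented_scaleAl c (a b : presented) : c *: (a * b) = (c *: a) * b.
Proof. by rewrite -(prK a) -(prK b) -prM -!prZ -prM scalerAl. Qed.

Lemma malgC_central c (f : F) : c%:MP * f = f * c%:MP.
Proof.
have C (e : K) (m : {fmonom I}) : c%:MP * << e *g m >> = << e *g m >> * c%:MP :> F.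
  by rewrite !malgM_def !fgmulUU mul1m mulm1 mulrC.
by rewrite [f]monalgE mulr_sumr mulr_suml; apply: eq_bigr => m _; exact: C.
Qed.

Lemma presented_scaleAr c (a b : presented) : c *: (a * b) = a * (c *: b).
Proof.
rewrite -(prK a) -(prK b) -prM -!prZ -prM; congr pr.
by rewrite -!mul_malgC !mulrA malgC_central.
Qed.

Definition of_scalar (c : K) : presented := c *: (1 : presented).

(* Restriction of scalars to K of a right module over the presented algebra. *)
Definition restrict_scalars (M : lmodType presented^c) : Type := M.

Section Restriction.
Variable M : lmodType presented^c.
HB.instance Definition _ := GRing.Zmodule.on (restrict_scalars M).

Definition restrict_scale (c : K) (m : restrict_scalars M) :
  restrict_scalars M := (of_scalar c : presented^c) *: (m : M).

Fact restrict_scaleA c d m :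
  restrict_scale c (restrict_scale d m) = restrict_scale (c * d) m.
Proof.
rewrite /restrict_scale scalerA; congr (_ *: _).
rewrite -[LHS]/(of_scalar d * of_scalar c) /of_scalar.
by rewrite -presented_scaleAl mul1r scalerA mulrC.
Qed.

Fact restrict_scale1 : left_id 1 restrict_scale.
Proof. by move=> m; rewrite /restrict_scale /of_scalar !scale1r. Qed.

Fact restrict_scaleDr : right_distributive restrict_scale +%R.
Proof. by move=> c m n; rewrite /restrict_scale scalerDr. Qed.

Fact restrict_scaleDl m : {morph restrict_scale^~ m : c d / c + d}.
Proof. by move=> c d; rewrite /restrict_scale /of_scalar !scalerDl. Qed.

HB.instance Definition _ :=
  GRing.Zmodule_isLmodule.Build K (restrict_scalars M)
  restrict_scaleA restrict_scale1 restrict_scaleDr restrict_scaleDl.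
End Restriction.

End PresentedAlgebra.

Definition has_dim (K : nzRingType) (V : lmodType K) (n : nat) : Prop :=
  inhabited (Vector.axiom n V).

(* Right A-modules are the lmodTypes over the converse ring A^c. *)

Section RightModules.
Variable A : pzRingType.

Definition ract (M : lmodType A^c) (m : M) (a : A) : M := (a : A^c) *: m.

Lemma ractM (M : lmodType A^c) (m : M) (a b : A) :
  ract m (a * b) = ract (ract m a) b.
Proof. by rewrite /ract scalerA. Qed.

Definition submodule (M : lmodType A^c) (N : M -> Prop) : Prop :=
  [/\ N 0, forall u v, N u -> N v -> N (u + v) &
      forall u a, N u -> N (ract u a)].

Definition simple_module (M : lmodType A^c) : Prop :=
  (exists m : M, m <> 0) /\
  forall N : M -> Prop, submodule N ->
    (forall m, N m -> m = 0) \/ (forall m, N m).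

Definition isomorphic (M M' : lmodType A^c) : Prop :=
  exists f : {linear M -> M'}, bijective f.

Definition acts_invertibly (M : lmodType A^c) (a : A) : Prop :=
  bijective (fun m : M => ract m a).

Definition acts_nilpotently (M : lmodType A^c) (a : A) : Prop :=
  exists n : nat, forall m : M, ract m (a ^+ n) = 0.

End RightModules.

Notation "m *> a" := (ract m a) (at level 40, left associativity) : ring_scope.

(* x1, y1, x2, y2 are the generators 0, 1, 2, 3. *)

Section Relators.
Variables (K : fieldType) (q1 q2 lambda : K).

Definition gen (i : 'I_4) : free_alg K 'I_4 := << fmu i >>.
Local Notation X1 := (gen (@Ordinal 4 0 isT)).
Local Notation Y1 := (gen (@Ordinal 4 1 isT)).
Local Notation X2 := (gen (@Ordinal 4 2 isT)).
Local Notation Y2 := (gen (@Ordinal 4 3 isT)).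

Definition A2_rels : seq (free_alg K 'I_4) :=
  [:: X1 * X2 - (q1 * lambda) *: (X2 * X1);
      X1 * Y2 - lambda^-1 *: (Y2 * X1);
      Y1 * Y2 - lambda *: (Y2 * Y1);
      Y1 * X2 - (q1^-1 * lambda^-1) *: (X2 * Y1);
      X1 * Y1 - q1 *: (Y1 * X1) - 1;
      X2 * Y2 - q2 *: (Y2 * X2) - (1 + (q1 - 1) *: (Y1 * X1))].

End Relators.

Notation A2 q1 q2 lambda := (presented (A2_rels q1 q2 lambda)).

Section QuantumWeyl.
Variables (K : fieldType) (q1 q2 lambda : K).
Local Notation X1 := (gen K (@Ordinal 4 0 isT)).
Local Notation Y1 := (gen K (@Ordinal 4 1 isT)).
Local Notation X2 := (gen K (@Ordinal 4 2 isT)).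
Local Notation Y2 := (gen K (@Ordinal 4 3 isT)).
Local Notation rels := (A2_rels q1 q2 lambda).
Local Notation A2 := (A2 q1 q2 lambda).

Definition x1 : A2 := pr rels X1.
Definition y1 : A2 := pr rels Y1.
Definition x2 : A2 := pr rels X2.
Definition y2 : A2 := pr rels Y2.
Definition z1 : A2 := x1 * y1 - y1 * x1.
Definition z2 : A2 := x2 * y2 - y2 * x2.

Fact A2_rel (i : nat) f g : (i < size rels)%N ->
  nth 0 rels i = f - g -> pr rels f = pr rels g.
Proof.
move=> ltis e; apply/pr_eqP; apply: ideal_rel; rewrite -e; exact: mem_nth.
Qed.

Lemma x1x2E : x1 * x2 = (q1 * lambda) *: (x2 * x1).
Proof. rewrite /x1 /x2 -!prM -prZ; exact: (@A2_rel 0). Qed.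

Lemma x1y2E : x1 * y2 = lambda^-1 *: (y2 * x1).
Proof. rewrite /x1 /y2 -!prM -prZ; exact: (@A2_rel 1). Qed.

Lemma y1y2E : y1 * y2 = lambda *: (y2 * y1).
Proof. rewrite /y1 /y2 -!prM -prZ; exact: (@A2_rel 2). Qed.

Lemma y1x2E : y1 * x2 = (q1^-1 * lambda^-1) *: (x2 * y1).
Proof. rewrite /y1 /x2 -!prM -prZ; exact: (@A2_rel 3). Qed.

Lemma x1y1E : x1 * y1 - q1 *: (y1 * x1) = 1.
Proof.
apply/eqP; rewrite subr_eq addrC; apply/eqP.
rewrite /x1 /y1 -pr1 -!prM -prZ -prD.
by apply: (@A2_rel 4); rewrite //= opprD addrA.
Qed.

Lemma x2y2E : x2 * y2 - q2 *: (y2 * x2) = 1 + (q1 - 1) *: (y1 * x1).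
Proof.
apply/eqP; rewrite subr_eq addrC; apply/eqP.
rewrite /x1 /y1 /x2 /y2 -pr1 -!prM -!prZ -!prD.
by apply: (@A2_rel 5); rewrite //= [in RHS]opprD addrA.
Qed.

Definition type_M4 (l1 l2 : nat) (eta1 eta2 zeta1 zeta2 : K)
    (M : lmodType A2^c) : Prop :=
  [/\ simple_module M,
      acts_invertibly M z1 /\ acts_invertibly M z2,
      acts_nilpotently M x1 /\ acts_nilpotently M x2 &
      exists w : M,
        [/\ w <> 0,
            w *> x1 = 0 /\ w *> x2 = 0,
            w *> y1 ^+ l1 = w *> of_scalar rels eta1 /\
            w *> y2 ^+ l2 = w *> of_scalar rels eta2 &
            w *> z1 = w *> of_scalar rels zeta1 /\
            w *> z2 = w *> of_scalar rels zeta2]].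

End QuantumWeyl.

(* Main.v *)
Require Import Defs.
From HB Require Import structures.
From mathcomp Require Import all_boot all_algebra.
From mathcomp Require Import monalg boolp zify ring.

(* The highest weight vector w determines everything.  From w x_1 = w x_2 = 0
   the defining relations force zeta_1 = q_1^-1 and zeta_2 = q_1^-1 q_2^-1, so
   in the classification the zeta's carry no information (a = b = 0).  The
   vectors w y_1^i y_2^j with i < l_1 and j < l_2 span a submodule, hence M.
   They are independent: in a combination c <> 0 take (i, j) with c_ij <> 0 and
   i + j maximal; then x_2^j x_1^i kills every other term and sends this one to
   a nonzero multiple of w.  The same argument shows that only multiples of w
   are killed by x_1 and x_2, so an isomorphism matches the highest weight
   vectors and hence eta_1, eta_2.  Conversely, if the eta's agree, the spanning
   argument applied to (w, w') in M * M' shows that w and w' have the same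
   annihilator, and w a |-> w' a is an isomorphism. *)

Set Implicit Arguments.
Unset Strict Implicit.
Unset Printing Implicit Defensive.

Import GRing.Theory.
Local Open Scope ring_scope.

(** * Right multiplications as operators *)

Section Action.
Variables (K : comNzRingType) (I : choiceType) (rels : seq (free_alg K I)).
Local Notation A := (presented rels).
Variable M : lmodType A^c.
Local Notation V := (restrict_scalars M).

Definition kact (a : A) (v : V) : V := (v : M) *> a.

(** Scalars of [K] act through [of_scalar], which is central in the presented algebra. *)
Fact kact_linear a : linear (kact a).
Proof.
move=> c u v; rewrite /kact /ract scalerDr; congr (_ + _).
rewrite -[LHS]/((u : M) *> of_scalar rels c *> a).
rewrite -[RHS]/((u : M) *> a *> of_scalar rels c) -!ractM /of_scalar.
by rewrite -presented_scaleAl -presented_scaleAr mul1r mulr1.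
Qed.
HB.instance Definition _ (a : A) :=
  GRing.isLinear.Build K V V *:%R (kact a) (kact_linear a).

Lemma kactM a b v : kact (a * b) v = kact b (kact a v).
Proof. exact: ractM. Qed.

Lemma kact1 v : kact 1 v = v.
Proof. exact: (scale1r (v : M)). Qed.

Lemma kactD a b v : kact (a + b) v = kact a v + kact b v.
Proof. exact: (scalerDl (v : M)). Qed.

Lemma kactZ c a v : kact (c *: a) v = c *: kact a v.
Proof.
by rewrite -{1}[a]mulr1 presented_scaleAr kactM.
Qed.

Lemma kactB a b v : kact (a - b) v = kact a v - kact b v.
Proof. exact: (scalerBl (a : A^c) b (v : M)). Qed.

(** Every algebra element is the image of a linear combination of words, and a word acts one
    generator at a time. This reduces stability under the whole algebra to stability under the
    generators. *)
Lemma kact_ind (P : V -> Prop) :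
    P 0 -> (forall u v, P u -> P v -> P (u + v)) ->
    (forall c u, P u -> P (c *: u)) ->
    (forall i u, P u -> P (kact (pr rels << fmu i >>) u)) ->
  forall a u, P u -> P (kact a u).
Proof.
move=> P0 PD PZ Pg.
have Pm (m : {fmonom I}) : forall (c : K) (u : V), P u ->
    P (kact (pr rels (<< c *g m >> : free_alg K I)) u).
  rewrite -[m]fmK; elim: (m : seq I) => [|i t IHt] c u Pu.
    rewrite (_ : << c *g FMonom [::] >> = c *: (1 : free_alg K I)).
      by rewrite prZ pr1 kactZ kact1; exact: PZ.
    by rewrite -mul_malgC mulr1 -fmoneE.
  rewrite (_ : << c *g FMonom (i :: t) >> =
               << fmu i >> * << c *g FMonom t >> :> free_alg K I).
    by rewrite prM kactM; apply: IHt; exact: Pg.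
  rewrite malgM_def fgmulUU mul1r; congr << _ *g _ >>.
  by rewrite /mmul /= fmmulE fmuE.
move=> a u Pu; rewrite -(prK a) [repr _]monalgE.
apply: (big_ind (fun g => P (kact (pr rels g) u))) => [|g h Pg' Ph|m _].
- have -> : pr rels 0 = 0.
    by rewrite -(subrr 0) -[in LHS]scaleN1r prD prZ scaleN1r subrr.
  by rewrite [kact _ _](scale0r (u : M)).
- by rewrite prD kactD; apply: PD.
- exact: Pm.
Qed.
End Action.

(** * Pairs in the product of two modules *)

Section ProductModule.
Variables (K : comNzRingType) (I : choiceType) (rels : seq (free_alg K I)).
Local Notation A := (presented rels).
Variables M M' : lmodType A^c.
Let N : lmodType A^c := (M * M')%type.

Definition rpair (v : restrict_scalars M) (v' : restrict_scalars M') :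
  restrict_scalars N := (v : M, v' : M').

Lemma kact_pair a v v' : kact a (rpair v v') = rpair (kact a v) (kact a v').
Proof. by []. Qed.

Lemma scale_rpair c v v' : c *: rpair v v' = rpair (c *: v) (c *: v').
Proof. by []. Qed.

Lemma rpair0 : rpair 0 0 = 0.
Proof. by []. Qed.

Lemma rpair_inj u u' v v' : rpair u u' = rpair v v' -> u = v /\ u' = v'.
Proof. by case. Qed.
End ProductModule.

(** These are the factors by which [X1] and [X2] lower weight vectors; they must not vanish before
    the order is reached. *)
Lemma prim_expV_neq1 (K : fieldType) n (q : K) i :
  n.-primitive_root q -> (0 < i < n)%N -> q^-1 ^+ i - 1 != 0.
Proof.
move=> qn /andP[i0 ilt]; rewrite subr_eq0 exprVn invr_eq1 -(prim_order_dvd qn).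
by rewrite gtnNdvd.
Qed.

(** * Operators commuting up to a scalar *)

Section QCommutingOperators.
Variables (K : fieldType) (V : lmodType K).
Implicit Types (f g : {linear V -> V}) (F G : V -> V) (c q : K).

Fact iter_is_linear n f : linear (iter n f).
Proof. by elim: n => [//|n IH] c u v; rewrite !iterS IH linearP. Qed.
HB.instance Definition _ n f :=
  GRing.isLinear.Build K V V *:%R (iter n f) (iter_is_linear n f).

Lemma iterZ n f c v : iter n f (c *: v) = c *: iter n f v.
Proof. exact: linearZ. Qed.

Lemma qcomm_iterl c f G n : (forall v, f (G v) = c *: G (f v)) ->
  forall v, iter n f (G v) = c ^+ n *: G (iter n f v).
Proof.
move=> fG; elim: n => [|n IH] v; first by rewrite scale1r.
by rewrite !iterS IH linearZ /= fG scalerA exprSr.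
Qed.

Lemma qcomm_iterr c F g n : (forall v, F (g v) = c *: g (F v)) ->
  forall v, F (iter n g v) = c ^+ n *: iter n g (F v).
Proof.
move=> Fg; elim: n => [|n IH] v; first by rewrite scale1r.
by rewrite !iterS Fg IH linearZ /= scalerA exprS.
Qed.

Lemma qcomm_sym c F G : c != 0 -> (forall v, F (G v) = c *: G (F v)) ->
  forall v, G (F v) = c^-1 *: F (G v).
Proof. by move=> c0 FG v; rewrite FG scalerA mulVf // scale1r. Qed.

(* Operators stand for right multiplications, hence compose in reverse order:
   Y (X v) is v x y. *)
Variables (X Y Z : {linear V -> V}) (q : K).
Hypotheses (q0 : q != 0) (YXE : forall v, Y (X v) - q *: X (Y v) = Z v).
Let T v := Y (X v) - X (Y v).

(** This and [qweyl_r] eliminate one of the two products from the commutator [T]. They serve twice: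
    for the first pair of generators with [Z] the identity, for the second with [Z] the action of
    $z_1$. *)
Lemma qweyl_l v : T v = Z v + (q - 1) *: X (Y v).
Proof. by rewrite -YXE scalerBl scale1r addrA subrK. Qed.

Lemma qweyl_r v : T v = q^-1 *: (Z v + (q - 1) *: Y (X v)).
Proof.
rewrite -YXE scalerBl scale1r addrC addrA subrK -scalerBr scalerA mulVf //.
by rewrite scale1r.
Qed.

(** Expanding [T (Y v)] by [qweyl_r] gives [Z (Y v)] and [Y (X (Y v))]; pulling [Y] out leaves
    exactly the [qweyl_l] form of [T v]. *)
Lemma qweyl_qcomm : (forall v, Z (Y v) = Y (Z v)) ->
  forall v, T (Y v) = q^-1 *: Y (T v).
Proof.
move=> ZY v; rewrite qweyl_r qweyl_l ZY.
by rewrite [Y (_ + _)]linearD [Y (_ *: _)]linearZ.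
Qed.

Lemma qweyl_highest v c : X v = 0 -> Z v = c *: v -> T v = (q^-1 * c) *: v.
Proof.
by move=> Xv Zv; rewrite qweyl_r Xv Zv linear0 scaler0 addr0 scalerA.
Qed.

(** On a common eigenvector of [T] and [Z], this makes [X] undo [Y] up to an explicit scalar. *)
Lemma qweyl_lower v : q != 1 -> X (Y v) = (q - 1)^-1 *: (T v - Z v).
Proof.
move=> q1; rewrite qweyl_l [Z v + _]addrC addrK.
by rewrite scalerA mulVf ?subr_eq0 // scale1r.
Qed.
End QCommutingOperators.

(** * Highest weight vectors *)

Section HighestWeightVector.
Variables (K : fieldType) (V : lmodType K) (q1 q2 lambda : K) (l1 l2 : nat).
Variables (X1 Y1 X2 Y2 : {linear V -> V}).
Hypotheses (q1_neq0 : q1 != 0) (q1_neq1 : q1 != 1).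
Hypotheses (q2_neq0 : q2 != 0) (q2_neq1 : q2 != 1) (lambda_neq0 : lambda != 0).
Hypotheses (q1_prim : l1.-primitive_root q1) (q2_prim : l2.-primitive_root q2).
Hypothesis Y2X1 : forall v, Y2 (X1 v) = lambda^-1 *: X1 (Y2 v).
Hypothesis Y2Y1 : forall v, Y2 (Y1 v) = lambda *: Y1 (Y2 v).
Hypothesis X2Y1 : forall v, X2 (Y1 v) = (q1^-1 * lambda^-1) *: Y1 (X2 v).
Let Z1 v := Y1 (X1 v) - X1 (Y1 v).
Let Z2 v := Y2 (X2 v) - X2 (Y2 v).
Hypothesis Y1X1 : forall v, Y1 (X1 v) - q1 *: X1 (Y1 v) = v.
Hypothesis Y2X2 :
  forall v, Y2 (X2 v) - q2 *: X2 (Y2 v) = v + (q1 - 1) *: X1 (Y1 v).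

Variables (w : V) (eta1 eta2 : K).
Hypotheses (X1w : X1 w = 0) (X2w : X2 w = 0).
Hypotheses (Y1w : iter l1 Y1 w = eta1 *: w) (Y2w : iter l2 Y2 w = eta2 *: w).

Let Z1E v : Z1 v = v + (q1 - 1) *: X1 (Y1 v).
Proof. exact: (@qweyl_l _ _ X1 Y1 idfun q1 Y1X1). Qed.

Fact Z1_linear : linear Z1.
Proof.
move=> c u v; rewrite /Z1 !(linearP X1, linearP Y1) /=.
by rewrite opprD scalerBr addrACA.
Qed.
HB.instance Definition _ := GRing.isLinear.Build K V V *:%R Z1 Z1_linear.

(** Since $z_1 = 1 + (q_1-1)y_1x_1$, the second pair satisfies a q-Weyl relation with inhomogeneous
    term [Z1]. *)
Let Y2X2Z v : Y2 (X2 v) - q2 *: X2 (Y2 v) = Z1 v.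
Proof. by rewrite Y2X2 Z1E. Qed.

Let Z2E v : Z2 v = Z1 v + (q2 - 1) *: X2 (Y2 v).
Proof. exact: (@qweyl_l _ _ X2 Y2 Z1 q2 Y2X2Z). Qed.

Let X1Y2 v : X1 (Y2 v) = lambda *: Y2 (X1 v).
Proof. by rewrite Y2X1 scalerA mulfV // scale1r. Qed.

Let Y1Y2 v : Y1 (Y2 v) = lambda^-1 *: Y2 (Y1 v).
Proof. exact: qcomm_sym. Qed.

Let Z1Y2 v : Z1 (Y2 v) = Y2 (Z1 v).
Proof.
by rewrite !Z1E linearD linearZ /= Y1Y2 linearZ /= X1Y2 [lambda^-1 *: _]scalerA
  mulVf // scale1r.
Qed.

Let Z1Y1 v : Z1 (Y1 v) = q1^-1 *: Y1 (Z1 v).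
Proof. exact: (@qweyl_qcomm _ _ X1 Y1 idfun q1). Qed.

Let Z2Y2 v : Z2 (Y2 v) = q2^-1 *: Y2 (Z2 v).
Proof. exact: (@qweyl_qcomm _ _ X2 Y2 Z1 q2). Qed.

(** Passing [Y1] costs [lambda] at [Y2] and [q1^-1 * lambda^-1] at [X2]; the product [q1^-1] is also
    the cost at [Z1]. *)
Let Z2Y1 v : Z2 (Y1 v) = q1^-1 *: Y1 (Z2 v).
Proof.
rewrite !Z2E linearD linearZ /= Y2Y1 linearZ /= X2Y1 Z1Y1 scalerDr.
rewrite !scalerA; congr (_ + _ *: _); field.
by rewrite q1_neq0 lambda_neq0.
Qed.

Lemma Z1_highest : Z1 w = q1^-1 *: w.
Proof.
rewrite -[q1^-1]mulr1; apply: (@qweyl_highest _ _ X1 Y1 idfun) => //=.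
by rewrite scale1r.
Qed.

Lemma Z2_highest : Z2 w = (q2^-1 * q1^-1) *: w.
Proof. exact: (@qweyl_highest _ _ X2 Y2 Z1 q2 _ _ _ _ X2w Z1_highest). Qed.

(** * Weight vectors $w y_1^i y_2^j$ and the action of the generators on them *)

Definition wt i j : V := iter j Y2 (iter i Y1 w).

Lemma Z1_wt i j : Z1 (wt i j) = q1^-1 ^+ i.+1 *: wt i j.
Proof.
rewrite /wt (qcomm_iterr (c := 1)); last by move=> v; rewrite scale1r.
rewrite expr1n scale1r (qcomm_iterr _ Z1Y1) Z1_highest !iterZ scalerA.
by rewrite -exprSr.
Qed.

Lemma Z2_wt i j : Z2 (wt i j) = (q1^-1 ^+ i.+1 * q2^-1 ^+ j.+1) *: wt i j.
Proof.
rewrite /wt (qcomm_iterr _ Z2Y2) (qcomm_iterr _ Z2Y1) Z2_highest.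
rewrite !iterZ !scalerA; congr (_ *: _).
by rewrite !exprSr; ring.
Qed.

Lemma Y1_wt i j : Y1 (wt i j) = lambda^-1 ^+ j *: wt i.+1 j.
Proof. exact: qcomm_iterr. Qed.

Lemma X1_wt0 j : X1 (wt 0 j) = 0.
Proof. by rewrite /wt (qcomm_iterr _ X1Y2) X1w linear0 scaler0. Qed.

Lemma X2_wt0 i : X2 (wt i 0) = 0.
Proof. by rewrite /wt (qcomm_iterr _ X2Y1) X2w linear0 scaler0. Qed.

(** Moving [X1] past the [j] copies of [Y2] costs [lambda ^+ j]; then [qweyl_lower] applies to a
    [Z1]-eigenvector. *)
Lemma X1_wtS i j : X1 (wt i.+1 j) =
  (lambda ^+ j * ((q1 - 1)^-1 * (q1^-1 ^+ i.+1 - 1))) *: wt i j.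
Proof.
rewrite /wt (qcomm_iterr _ X1Y2) iterS.
rewrite (@qweyl_lower _ _ X1 Y1 idfun q1) // -/(Z1 _) (Z1_wt i 0).
by rewrite -[X in _ *: _ - X]scale1r -scalerBl scalerA iterZ scalerA.
Qed.

(** The scalar is the difference of the [Z2]- and [Z1]-eigenvalues of [wt i j], divided by
    [q2 - 1]. *)
Lemma X2_wtS i j : X2 (wt i j.+1) =
  ((q2 - 1)^-1 * (q1^-1 ^+ i.+1 * (q2^-1 ^+ j.+1 - 1))) *: wt i j.
Proof.
rewrite /wt iterS (@qweyl_lower _ _ X2 Y2 Z1 q2) // -/(Z2 _) -/(wt i j).
by rewrite /= Z1_wt Z2_wt -scalerBl scalerA [in RHS]mulrBr mulr1.
Qed.

Lemma wt_l1 j : wt l1 j = eta1 *: wt 0 j.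
Proof. by rewrite /wt Y1w iterZ. Qed.

Lemma wt_l2 i : wt i l2 = (lambda ^+ i ^+ l2 * eta2) *: wt i 0.
Proof.
rewrite /wt (qcomm_iterl (G := iter i Y1) _ (qcomm_iterr _ Y2Y1)).
by rewrite Y2w iterZ scalerA.
Qed.

(** The exponents met on the way down lie strictly between 0 and the order of [q1], so no factor of
    [X1_wtS] vanishes. *)
Lemma iter_X1_wt n i j : (n + i < l1)%N ->
  exists2 k, k != 0 & iter n X1 (wt (n + i) j) = k *: wt i j.
Proof.
elim: n => [|n IH] lt; first by exists 1; rewrite ?oner_eq0 ?scale1r.
have [k k0 e] := IH (ltnW lt).
eexists; last by rewrite iterSr addSn X1_wtS iterZ e scalerA.
rewrite !mulf_neq0 ?invr_eq0 ?subr_eq0 ?expf_neq0 // -subr_eq0.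
exact: (prim_expV_neq1 q1_prim).
Qed.

Lemma iter_X2_wt n i j : (n + j < l2)%N ->
  exists2 k, k != 0 & iter n X2 (wt i (n + j)) = k *: wt i j.
Proof.
elim: n => [|n IH] lt; first by exists 1; rewrite ?oner_eq0 ?scale1r.
have [k k0 e] := IH (ltnW lt).
eexists; last by rewrite iterSr addSn X2_wtS iterZ e scalerA.
rewrite !mulf_neq0 ?invr_eq0 ?subr_eq0 ?expf_neq0 ?invr_eq0 // -subr_eq0.
exact: (prim_expV_neq1 q2_prim).
Qed.

Lemma iter_X1_wt_gt n i j : (i < l1)%N -> (i < n)%N -> iter n X1 (wt i j) = 0.
Proof.
move=> il ni; have [] := @iter_X1_wt i 0 j; first by rewrite addn0.
rewrite addn0 => k _ e; rewrite -(subnK ni) iterD iterS e linearZ /= X1_wt0.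
by rewrite scaler0 linear0.
Qed.

Lemma iter_X2_wt_gt n i j : (j < l2)%N -> (j < n)%N -> iter n X2 (wt i j) = 0.
Proof.
move=> jl nj; have [] := @iter_X2_wt j i 0; first by rewrite addn0.
rewrite addn0 => k _ e; rewrite -(subnK nj) iterD iterS e linearZ /= X2_wt0.
by rewrite scaler0 linear0.
Qed.

(** * Independence of the weight vectors *)

Definition comb (c : 'M[K]_(l1, l2)) : V :=
  \sum_(i < l1) \sum_(j < l2) c i j *: wt i j.

Fact comb_is_linear : linear comb.
Proof.
move=> a c d; rewrite /comb scaler_sumr -big_split; apply: eq_bigr => i _ /=.
rewrite scaler_sumr -big_split; apply: eq_bigr => j _ /=.
by rewrite !mxE scalerDl scalerA.
Qed.
HB.instance Definition _ := GRing.isLinear.Build K _ V *:%R comb comb_is_linear.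

Lemma lower_wt_eq0 i j i' j' : (i' < l1)%N -> (j' < l2)%N ->
  (i' < i)%N || (j' < j)%N -> iter i X1 (iter j X2 (wt i' j')) = 0.
Proof.
move=> il jl; have [lt _|le] := ltnP j' j.
  by rewrite iter_X2_wt_gt // linear0.
rewrite orbF => lt; have [|k _] := @iter_X2_wt j i' (j' - j); rewrite subnKC //.
by move=> ->; rewrite iterZ iter_X1_wt_gt // scaler0.
Qed.

Lemma lower_top (c : 'M[K]_(l1, l2)) (i : 'I_l1) (j : 'I_l2) :
    c i j != 0 -> (forall i' j', c i' j' != 0 -> (i' + j' <= i + j)%N) ->
  exists2 k, k != 0 & iter i X1 (iter j X2 (comb c)) = k *: w.
Proof.
move=> cij cmax.
have [|k k0] := @iter_X2_wt j i 0; rewrite addn0 // => ek.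
have [|h h0] := @iter_X1_wt i 0 0; rewrite addn0 // => eh.
exists (c i j * k * h); first by rewrite !mulf_neq0.
have vanish (i' : 'I_l1) (j' : 'I_l2) : (i' != i) || (j' != j) ->
    iter i X1 (iter j X2 (c i' j' *: wt i' j')) = 0.
  move=> ne; have [->|/cmax le] := eqVneq (c i' j') 0.
    by rewrite scale0r !linear0.
  rewrite !iterZ lower_wt_eq0 ?scaler0 //.
  (* If both $i \le i'$ and $j \le j'$, maximality of $i + j$ forces $(i',j') = (i,j)$. *)
  rewrite ltnNge [(j' < j)%N]ltnNge -negb_and.
  apply: contraL ne => /andP[li lj].
  rewrite negb_or !negbK -!val_eqE /= !eqn_leq li lj !andbT.
  by apply/andP; split; move: le li lj; clear; lia.
rewrite /comb !linear_sum (bigD1 i) //= !linear_sum (bigD1 j) //=.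
rewrite !iterZ ek !iterZ eh !scalerA !big1 ?addr0 // => [i' ni|j' nj].
  by rewrite !linear_sum big1 // => j' _; rewrite /= vanish ?ni.
by rewrite vanish ?nj ?orbT.
Qed.

Lemma comb_top (c : 'M[K]_(l1, l2)) : c != 0 ->
  exists (i : 'I_l1) (j : 'I_l2), c i j != 0 /\
    forall i' j', c i' j' != 0 -> (i' + j' <= i + j)%N.
Proof.
move=> c0; have [p cp] : exists p : 'I_l1 * 'I_l2, c p.1 p.2 != 0.
  apply/existsP; apply: contra_neqT c0 => /existsPn c0; apply/matrixP => i j.
  by rewrite mxE; apply/eqP; rewrite -[_ == _]negbK; exact: (c0 (i, j)).
have [[i j] cij cmax] :=
  @arg_maxnP _ p (fun p => c p.1 p.2 != 0) (fun p => p.1 + p.2)%N cp.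
by exists i, j; split=> // i' j' /(cmax (i', j')).
Qed.

Hypothesis w_neq0 : w != 0.

Lemma comb_eq0 (c : 'M[K]_(l1, l2)) : comb c = 0 -> c = 0.
Proof.
move=> e; apply/eqP; apply/negPn/negP => /comb_top[i [j [cij cmax]]].
have [k k0] := lower_top cij cmax.
rewrite e !linear0 => /esym/eqP.
by rewrite scaler_eq0 (negPf k0) (negPf w_neq0).
Qed.

(** For a top index [(i, j)], lowering by [X2] [j] times and by [X1] [i] times gives a nonzero
    multiple of [w]. As [X1] and [X2] kill the vector, no lowering took place: [i = j = 0], and the
    vector is that multiple. *)
Lemma comb_highest (c : 'M[K]_(l1, l2)) :
  X1 (comb c) = 0 -> X2 (comb c) = 0 -> exists k, comb c = k *: w.
Proof.
move=> X1c X2c; have [->|/comb_top[i [j [cij cmax]]]] := eqVneq c 0.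
  by exists 0; rewrite linear0 scale0r.
have [k k0 e] := lower_top cij cmax.
have wk : k *: w != 0 by rewrite scaler_eq0 negb_or k0.
have j0 : j = 0%N :> nat.
  apply/eqP; move: wk; apply: contra_neqT; rewrite -lt0n => /prednK j1.
  by rewrite -e -j1 iterSr X2c !linear0.
have i0 : i = 0%N :> nat.
  apply/eqP; move: wk; apply: contra_neqT; rewrite -lt0n => /prednK i1.
  by rewrite -e j0 -i1 iterSr X1c linear0.
by exists k; rewrite -e i0 j0.
Qed.

(** * Stability of the span of the weight vectors *)

Definition spanned v : Prop := exists c, v = comb c.

Lemma spanned_wt i j : (i < l1)%N -> (j < l2)%N -> spanned (wt i j).
Proof.
move=> il jl; exists (delta_mx (Ordinal il) (Ordinal jl)).
rewrite /comb (bigD1 (Ordinal il)) //= (bigD1 (Ordinal jl)) //=.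
rewrite mxE !eqxx scale1r !big1 ?addr0 // => [i' /negPf ni|j' /negPf nj].
  by rewrite big1 // => j' _; rewrite mxE ni scale0r.
by rewrite mxE nj andbF scale0r.
Qed.

Lemma spanned0 : spanned 0.
Proof. by exists 0; rewrite linear0. Qed.

Lemma spannedD u v : spanned u -> spanned v -> spanned (u + v).
Proof. by move=> [c ->] [d ->]; exists (c + d); rewrite linearD. Qed.

Lemma spannedZ k u : spanned u -> spanned (k *: u).
Proof. by move=> [c ->]; exists (k *: c); rewrite linearZ. Qed.

Lemma spanned_linear (f : {linear V -> V}) :
    (forall i j, (i < l1)%N -> (j < l2)%N -> spanned (f (wt i j))) ->
  forall v, spanned v -> spanned (f v).
Proof.
move=> fwt _ [c ->]; rewrite /comb linear_sum.
apply: big_ind => [|u v|i _]; [exact: spanned0 | exact: spannedD |].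
rewrite linear_sum.
apply: big_ind => [|u v|j _]; [exact: spanned0 | exact: spannedD |].
by rewrite linearZ; apply/spannedZ/fwt.
Qed.

Let l1_gt0 : (0 < l1)%N := prim_order_gt0 q1_prim.
Let l2_gt0 : (0 < l2)%N := prim_order_gt0 q2_prim.

Lemma spanned_X1 v : spanned v -> spanned (X1 v).
Proof.
apply: spanned_linear => -[|i] j il jl.
  by rewrite X1_wt0; exact: spanned0.
by rewrite X1_wtS; apply/spannedZ/spanned_wt => //; exact: ltnW.
Qed.

Lemma spanned_X2 v : spanned v -> spanned (X2 v).
Proof.
apply: spanned_linear => i [|j] il jl; first by rewrite X2_wt0; exact: spanned0.
by rewrite X2_wtS; apply/spannedZ/spanned_wt => //; exact: ltnW.
Qed.

Lemma spanned_Y1 v : spanned v -> spanned (Y1 v).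
Proof.
apply: spanned_linear => i j il jl; rewrite Y1_wt; apply: spannedZ.
case: (ltngtP i.+1 l1) il => // [lt _|-> _]; first exact: spanned_wt.
(* At the boundary [i.+1 = l1] the exponent wraps around to 0 with factor [eta1]. *)
by rewrite wt_l1; apply/spannedZ/spanned_wt.
Qed.

Lemma spanned_Y2 v : spanned v -> spanned (Y2 v).
Proof.
apply: spanned_linear => i j il jl; rewrite -[Y2 _]/(wt i j.+1).
case: (ltngtP j.+1 l2) jl => // [lt _|-> _]; first exact: spanned_wt.
by rewrite wt_l2; apply/spannedZ/spanned_wt.
Qed.
End HighestWeightVector.

(** * Modules over the quantum Weyl algebra *)

Section QuantumWeylModule.
Variables (K : fieldType) (q1 q2 lambda : K) (l1 l2 : nat).
Hypotheses (q1_neq0 : q1 != 0) (q1_neq1 : q1 != 1).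
Hypotheses (q2_neq0 : q2 != 0) (q2_neq1 : q2 != 1) (lambda_neq0 : lambda != 0).
Hypotheses (q1_prim : l1.-primitive_root q1) (q2_prim : l2.-primitive_root q2).
Local Notation A := (A2 q1 q2 lambda).
Local Notation rels := (A2_rels q1 q2 lambda).
Local Notation x1 := (x1 q1 q2 lambda).
Local Notation y1 := (y1 q1 q2 lambda).
Local Notation x2 := (x2 q1 q2 lambda).
Local Notation y2 := (y2 q1 q2 lambda).
Local Notation z1 := (z1 q1 q2 lambda).
Local Notation z2 := (z2 q1 q2 lambda).

(** Neither simplicity of [M] nor [w != 0] is built in, so that a pair in a product module can
    qualify. The eigenvalues of [z1] and [z2] follow in [highest_z1] and [highest_z2]. *)
Definition highest_weight (eta1 eta2 : K) (M : lmodType A^c)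
    (w : restrict_scalars M) : Prop :=
  [/\ kact x1 w = 0, kact x2 w = 0,
      kact (y1 ^+ l1) w = eta1 *: w & kact (y2 ^+ l2) w = eta2 *: w].

(** * The defining relations as operator identities on a module *)

Section Relations.
Variable M : lmodType A^c.
Local Notation V := (restrict_scalars M).
Implicit Type v : V.

Lemma kact_y2x1 v : kact y2 (kact x1 v) = lambda^-1 *: kact x1 (kact y2 v).
Proof. by rewrite -!kactM x1y2E kactZ. Qed.

Lemma kact_y2y1 v : kact y2 (kact y1 v) = lambda *: kact y1 (kact y2 v).
Proof. by rewrite -!kactM y1y2E kactZ. Qed.

Lemma kact_x2y1 v :
  kact x2 (kact y1 v) = (q1^-1 * lambda^-1) *: kact y1 (kact x2 v).
Proof. by rewrite -!kactM y1x2E kactZ. Qed.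

Lemma kact_y1x1 v : kact y1 (kact x1 v) - q1 *: kact x1 (kact y1 v) = v.
Proof. by rewrite -!kactM -kactZ -kactB x1y1E kact1. Qed.

Lemma kact_y2x2 v : kact y2 (kact x2 v) - q2 *: kact x2 (kact y2 v) =
  v + (q1 - 1) *: kact x1 (kact y1 v).
Proof. by rewrite -!kactM -!kactZ -kactB x2y2E kactD kact1. Qed.

Lemma kactXn (a : A) n v : kact (a ^+ n) v = iter n (kact a) v.
Proof.
elim: n v => [|n IH] v; first by rewrite expr0 kact1.
by rewrite exprS kactM IH iterSr.
Qed.

Lemma kact_z1 v : kact z1 v = kact y1 (kact x1 v) - kact x1 (kact y1 v).
Proof. by rewrite -!kactM -kactB. Qed.

Lemma kact_z2 v : kact z2 v = kact y2 (kact x2 v) - kact x2 (kact y2 v).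
Proof. by rewrite -!kactM -kactB. Qed.

Variables (eta1 eta2 : K) (w : V).
Hypothesis hw : highest_weight eta1 eta2 w.

Let X1w : kact x1 w = 0. Proof. by case: hw. Qed.
Let X2w : kact x2 w = 0. Proof. by case: hw. Qed.
Let Y1w : iter l1 (kact y1) w = eta1 *: w.
Proof. by case: hw => _ _ <- _; rewrite kactXn. Qed.
Let Y2w : iter l2 (kact y2) w = eta2 *: w.
Proof. by case: hw => _ _ _ <-; rewrite kactXn. Qed.

Lemma highest_z1 : kact z1 w = q1^-1 *: w.
Proof.
rewrite kact_z1; exact: (Z1_highest q1_neq0 kact_y1x1 X1w).
Qed.

Lemma highest_z2 : kact z2 w = (q2^-1 * q1^-1) *: w.
Proof.
rewrite kact_z2.
exact: (Z2_highest q1_neq0 q2_neq0 kact_y1x1 kact_y2x2 X1w X2w).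
Qed.
Lemma kact_highest_spanned a :
  spanned l1 l2 (kact y1) (kact y2) w (kact a w).
Proof.
apply: kact_ind => [|u v|c u||].
- exact: spanned0.
- exact: spannedD.
- exact: spannedZ.
(* [kact_ind] yields a generator index with an arbitrary bound proof; [genE] exchanges it for the
   one used in [x1], [y1], [x2], [y2]. *)
- have genE n (lt4 : (n < 4)%N) lt4' :
      pr rels << fmu (Ordinal lt4) >> = pr rels (gen K (@Ordinal 4 n lt4')).
    by congr (pr _ << fmu _ >>); exact: val_inj.
  case=> [[|[|[|[|//]]]] lt4] u; rewrite (genE _ lt4 isT).
  + exact: (spanned_X1 q1_neq0 q1_neq1 lambda_neq0 kact_y2x1 kact_y2y1
      kact_y1x1 X1w).
  + exact: (spanned_Y1 lambda_neq0 q1_prim kact_y2y1 Y1w).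
  + exact: (spanned_X2 q1_neq0 q2_neq0 q2_neq1 lambda_neq0 kact_y2x1 kact_y2y1
      kact_x2y1 kact_y1x1 kact_y2x2 X1w X2w).
  + exact: (spanned_Y2 q2_prim kact_y2y1 Y2w).
- rewrite -[w in spanned _ _ _ _ _ w]/(wt (kact y1) (kact y2) w 0 0).
  apply: spanned_wt; first exact: prim_order_gt0 q1_prim.
  exact: prim_order_gt0 q2_prim.
Qed.

Lemma kcomb_eq0 (c : 'M[K]_(l1, l2)) : w != 0 ->
  comb (kact y1) (kact y2) w c = 0 -> c = 0.
Proof.
move=> w0; apply: (comb_eq0 q1_neq0 q1_neq1 q2_neq0 q2_neq1 lambda_neq0
  q1_prim q2_prim kact_y2x1 kact_y2y1 kact_x2y1 kact_y1x1 kact_y2x2 X1w X2w).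
exact: w0.
Qed.

Lemma kcomb_highest (c : 'M[K]_(l1, l2)) : w != 0 ->
    kact x1 (comb (kact y1) (kact y2) w c) = 0 ->
    kact x2 (comb (kact y1) (kact y2) w c) = 0 ->
  exists k, comb (kact y1) (kact y2) w c = k *: w.
Proof.
move=> w0; apply: (comb_highest q1_neq0 q1_neq1 q2_neq0 q2_neq1 lambda_neq0
  q1_prim q2_prim kact_y2x1 kact_y2y1 kact_x2y1 kact_y1x1 kact_y2x2 X1w X2w).
exact: w0.
Qed.
End Relations.

(** An algebra element that realizes [comb] in every module at once, so coefficients can be carried
    from one module to another. *)
Definition word_comb (c : 'M[K]_(l1, l2)) : A :=
  \sum_(i < l1) \sum_(j < l2) c i j *: (y1 ^+ i * y2 ^+ j).

Lemma kact_word_comb (M : lmodType A^c) (w : restrict_scalars M) c :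
  kact (word_comb c) w = comb (kact y1) (kact y2) w c.
Proof.
have kact_sum (J : finType) (F : J -> A) :
    kact (\sum_i F i) w = \sum_i kact (F i) w.
  apply: (big_morph (fun a => kact a w)) => [a b|]; first exact: kactD.
  exact: (scale0r (w : M)).
rewrite kact_sum; apply: eq_bigr => i _.
rewrite kact_sum; apply: eq_bigr => j _.
by rewrite kactZ kactM !kactXn.
Qed.

Lemma scale_restrictE (M : lmodType A^c) (c : K) (v : restrict_scalars M) :
  c *: v = (v : M) *> of_scalar rels c.
Proof. by []. Qed.

(** * Simple modules of type $M_4$ *)

Section TypeM4.
Variables (eta1 eta2 zeta1 zeta2 : K) (M : lmodType A^c).
Hypothesis M4 : type_M4 l1 l2 eta1 eta2 zeta1 zeta2 M.
Local Notation V := (restrict_scalars M).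

Lemma type_M4_vector : exists w : V,
  [/\ w != 0, highest_weight eta1 eta2 w, kact z1 w = zeta1 *: w
    & kact z2 w = zeta2 *: w].
Proof.
case: M4 => _ _ _ [w [w0 [wx1 wx2] [wy1 wy2] [wz1 wz2]]].
exists w; split; first by apply/eqP; exact: w0.
- split; [exact: wx1 | exact: wx2 | |]; rewrite scale_restrictE.
    exact: wy1.
  exact: wy2.
- rewrite scale_restrictE; exact: wz1.
- rewrite scale_restrictE; exact: wz2.
Qed.

Lemma type_M4_highest : exists w : V,
  [/\ w != 0, highest_weight eta1 eta2 w & forall v, exists a, v = kact a w].
Proof.
have [w [w0 hw _ _]] := type_M4_vector; exists w; split; [exact: w0|exact: hw|].
case: M4 => -[_ Msimple] _ _ _.
(* The cyclic submodule generated by [w] contains [w != 0], so simplicity makes it all of [M]. *)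
have [|N0|//] := Msimple (fun v : M => exists a, v = (w : M) *> a).
  split=> [|_ _ [a ->] [b ->]|_ b [a ->]].
  - by exists 0; rewrite /ract (scale0r (w : M)).
  - by exists (a + b); exact: esym (kactD a b (w : V)).
  - by exists (a * b); rewrite ractM.
by case/eqP: w0; apply: N0; exists 1; exact: esym (kact1 w).
Qed.

Lemma type_M4_zeta : zeta1 = q1^-1 /\ zeta2 = q2^-1 * q1^-1.
Proof.
have [w [w0 hw wz1 wz2]] := type_M4_vector.
have zI c d : c *: w = d *: w -> c = d.
  move/eqP; rewrite -subr_eq0 -scalerBl scaler_eq0 (negPf w0) orbF subr_eq0.
  by move/eqP.
split; apply: zI; first exact: etrans (esym wz1) (highest_z1 hw).
exact: etrans (esym wz2) (highest_z2 hw).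
Qed.

Lemma type_M4_dim : has_dim V (l1 * l2).
Proof.
have [w [w0 hw gen_w]] := type_M4_highest.
pose f := comb (kact y1) (kact y2) w : 'M[K]_(l1, l2) -> V.
have f_inj : injective f.
  move=> c d /eqP; rewrite -subr_eq0 -linearB => /eqP/(kcomb_eq0 hw w0)/eqP.
  by rewrite subr_eq0 => /eqP.
have f_surj v : exists c, f c = v.
  have [a ->] := gen_w v; have [c ->] := kact_highest_spanned hw a.
  by exists c.
(* [g] is the inverse of [f]; flattening matrices with [mxvec] gives the row vectors of length
   [l1 * l2] that [has_dim] asks for. *)
have [g gK] := choice f_surj.
constructor; exists (mxvec \o g).
  move=> a u v /=; rewrite -linearP; congr mxvec; apply: f_inj.
  rewrite gK; apply: esym.
  by rewrite [LHS]comb_is_linear -/(f _) -/(f (g v)) !gK.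
exists (f \o vec_mx) => u /=; first by rewrite mxvecK gK.
by rewrite -[RHS]vec_mxK; congr mxvec; apply: f_inj; rewrite gK.
Qed.

End TypeM4.

(** * Comparison of two modules with highest weight vectors *)

Lemma killed_highest (M : lmodType A^c) eta1 eta2 (w v : restrict_scalars M) :
    w != 0 -> highest_weight eta1 eta2 w ->
    (exists a, v = kact a w) -> kact x1 v = 0 -> kact x2 v = 0 ->
  exists k, v = k *: w.
Proof.
move=> w0 hw [a ->]; have [c ->] := kact_highest_spanned hw a.
exact: (kcomb_highest hw w0).
Qed.

(** The pair of [w] and [w'] is again a highest weight vector, so one matrix [c] expresses the
    action of [a] on both. Independence over [w] gives [c = 0], and the second component vanishes
    too. *)
Lemma highest_annihilator (M M' : lmodType A^c) eta1 eta2
    (w : restrict_scalars M) (w' : restrict_scalars M') a : w != 0 ->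
    highest_weight eta1 eta2 w -> highest_weight eta1 eta2 w' ->
  kact a w = 0 -> kact a w' = 0.
Proof.
move=> w0 [wx1 wx2 wy1 wy2] [wx1' wx2' wy1' wy2'] aw.
have hN : highest_weight eta1 eta2 (rpair w w').
  split; rewrite kact_pair.
  - by rewrite wx1 wx1' rpair0.
  - by rewrite wx2 wx2' rpair0.
  - by rewrite wy1 wy1' scale_rpair.
  - by rewrite wy2 wy2' scale_rpair.
have [c] := kact_highest_spanned hN a.
rewrite -kact_word_comb !kact_pair => /rpair_inj[e1 e2].
have c0 : c = 0.
  apply: (kcomb_eq0 (w := w) (And4 wx1 wx2 wy1 wy2)); first exact: w0.
  by rewrite -kact_word_comb -e1.
by rewrite e2 kact_word_comb c0 linear0.
Qed.

Lemma isomorphic_highest (M M' : lmodType A^c) eta1 eta2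
    (w : restrict_scalars M) (w' : restrict_scalars M') :
    w != 0 -> w' != 0 ->
    highest_weight eta1 eta2 w -> highest_weight eta1 eta2 w' ->
    (forall v, exists a, v = kact a w) -> (forall v, exists a, v = kact a w') ->
  isomorphic M M'.
Proof.
move=> w0 w0' hw hw' /choice[p pK] /choice[p' pK'].
(* [p v] is a chosen element carrying [w] to [v]; [fE] shows that [f] does not depend on the choice,
   because the annihilators agree. *)
pose f (v : restrict_scalars M) : restrict_scalars M' := kact (p v) w'.
pose f' (v : restrict_scalars M') : restrict_scalars M := kact (p' v) w.
have fE a : f (kact a w) = kact a w'.
  apply/eqP; rewrite -subr_eq0; apply/eqP.
  apply: etrans (esym (kactB _ _ _)) _.
  apply: (highest_annihilator w0 hw hw').
  by apply: etrans (kactB _ _ _) _; rewrite -pK subrr.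
have fE' a : f' (kact a w') = kact a w.
  apply/eqP; rewrite -subr_eq0; apply/eqP.
  apply: etrans (esym (kactB _ _ _)) _.
  apply: (highest_annihilator w0' hw' hw).
  by apply: etrans (kactB _ _ _) _; rewrite -pK' subrr.
have fP b u v : f (kact b u + v) = kact b (f u) + f v.
  by rewrite (pK u) (pK v) -kactM -kactD !fE kactD kactM.
have fK : cancel f f' by move=> v; rewrite (pK v) fE fE'.
have f'K : cancel f' f by move=> v; rewrite (pK' v) fE' fE.
pose fM : M -> M' := f.
have f_lin : linear fM by move=> b u v; exact: fP.
pose fL := GRing.isLinear.Build A^c M M' *:%R fM f_lin.
pose F : {linear M -> M'} := HB.pack fM fL.
exists F; exists f'; first exact: fK.
exact: f'K.
Qed.

Lemma isomorphic_highest_inv (M M' : lmodType A^c) eta1 eta2 eta1' eta2'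
    (w : restrict_scalars M) (w' : restrict_scalars M') :
    w != 0 -> w' != 0 ->
    highest_weight eta1 eta2 w -> highest_weight eta1' eta2' w' ->
    (forall v, exists a, v = kact a w') ->
  isomorphic M M' -> eta1 = eta1' /\ eta2 = eta2'.
Proof.
move=> w0 w0' [wx1 wx2 wy1 wy2] hw' gen_w' [f [f' fK _]].
pose h (v : restrict_scalars M) : restrict_scalars M' := f v.
have hE a v : h (kact a v) = kact a (h v).
  exact: (linearZ_LR f (a : A^c) (v : M)).
(* Scaling by [c] is the action of [of_scalar rels c], so [hE] covers it. *)
have hZ c v : h (c *: v) = c *: h v by exact: hE.
have h0 : h 0 = 0 := linear0 f.
have hw0 : h w != 0.
  apply: contra_neq w0 => e; rewrite -[w]fK -[0 in RHS]fK; congr f'.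
  by apply: etrans e _; rewrite linear0.
have [k hk] : exists k, h w = k *: w'.
  apply: (killed_highest w0' hw'); first exact: gen_w'.
    by rewrite -hE wx1.
  by rewrite -hE wx2.
have k0 : k != 0 by apply: contraNneq hw0 => k0; rewrite hk k0 scale0r.
(* Since [h w] is a nonzero multiple of [w'], an element acting by a scalar on each of [w] and [w']
   has the same scalar on both. *)
have eigen a c c' : kact a w = c *: w -> kact a w' = c' *: w' -> c = c'.
  move=> /(congr1 h) + aw'; rewrite hE hZ hk linearZ /= aw' !scalerA => /eqP.
  rewrite -subr_eq0 -scalerBl scaler_eq0 (negPf w0') orbF mulrC -mulrBl.
  by rewrite mulf_eq0 (negPf k0) orbF subr_eq0 => /eqP.
case: hw' => _ _ wy1' wy2'.
by split; [exact: eigen wy1 wy1' | exact: eigen wy2 wy2'].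
Qed.
End QuantumWeylModule.

Theorem theorem4p5 (K : closedFieldType) (q1 q2 lambda : K) (l1 l2 : nat)
    (q1_neq0 : q1 != 0) (q1_neq1 : q1 != 1)
    (q2_neq0 : q2 != 0) (q2_neq1 : q2 != 1)
    (lambda_neq0 : lambda != 0)
    (q1_prim : l1.-primitive_root q1) (q2_prim : l2.-primitive_root q2)
    (lambda_l1 : lambda ^+ l1 = 1)
    (eta1 eta2 eta1' eta2' zeta1 zeta2 zeta1' zeta2' : K)
    (zeta1_neq0 : zeta1 != 0) (zeta2_neq0 : zeta2 != 0)
    (zeta1'_neq0 : zeta1' != 0) (zeta2'_neq0 : zeta2' != 0) :
  (forall M : lmodType (A2 q1 q2 lambda)^c,
     type_M4 l1 l2 eta1 eta2 zeta1 zeta2 M -> has_dim (restrict_scalars M) (l1 * l2)) /\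
  (forall M M' : lmodType (A2 q1 q2 lambda)^c,
     type_M4 l1 l2 eta1 eta2 zeta1 zeta2 M ->
     type_M4 l1 l2 eta1' eta2' zeta1' zeta2' M' ->
     (isomorphic M M' <->
      [/\ eta1 = eta1', eta2 = eta2' &
          exists a b : nat,
            [/\ (a <= l1 - 1)%N, (b <= l2 - 1)%N,
                zeta1 = q1 ^- a * zeta1' &
                zeta2 = q1 ^- a * q2 ^- b * zeta2']])).
Proof.
have dimM4 := type_M4_dim q1_neq0 q1_neq1 q2_neq0 q2_neq1 lambda_neq0 q1_prim
  q2_prim.
split=> [M M4|M M' M4 M4']; first exact: dimM4 M4.
have [z1E z2E] := type_M4_zeta q1_neq0 q2_neq0 M4.
have [z1E' z2E'] := type_M4_zeta q1_neq0 q2_neq0 M4'.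
have [w [w0 hw gen_w]] := type_M4_highest M4.
have [w' [w0' hw' gen_w']] := type_M4_highest M4'.
split=> [iso|[e1 e2 _]].
  have [-> ->] := isomorphic_highest_inv q1_neq0 q1_neq1 q2_neq0 q2_neq1
    lambda_neq0 q1_prim q2_prim w0 w0' hw hw' gen_w' iso.
  (* Both modules have the same forced values of the [zeta] parameters, so trivial exponents
     suffice. *)
  split=> //; exists 0, 0.
  by rewrite z1E z2E z1E' z2E' !expr0 invr1 !mul1r.
rewrite -e1 -e2 in hw'.
exact: (isomorphic_highest q1_neq0 q1_neq1 q2_neq0 q2_neq1 lambda_neq0 q1_prim
  q2_prim w0 w0' hw hw' gen_w gen_w').
Qed.
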